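(* Let $\mathcal I$ be an implication algebra. Let $\iota_{\mathcal I}\colon \mathcal I\to \mathsf{I}(\mathcal I)/\!\sim$ be the map $x\mapsto[\langle \mathbf 1,x\rangle]$, i.e. the composite of $e_{\mathcal I}\colon x\mapsto\langle\mathbf 1,x\rangle$ with the quotient map $\eta\colon \mathsf I(\mathcal I)\to\mathsf I(\mathcal I)/\!\sim$. Then $\iota_{\mathcal I}$ is an isomorphism of implication algebras.
   Context: An implication algebra is a set with a binary operation $\to$ satisfying $(x\to y)\to x=x$, $(x\to y)\to y=(y\to x)\to x$, $x\to(y\to z)=y\to(x\to z)$; it is a join-semilattice with top $\mathbf 1=x\to x$ (order $x\le y$ iff $x\to y=\mathbf 1$) in which every interval $[a,\mathbf 1]$ is a Boolean algebra, $x\to y$ being the complement of $x\vee y$ in $[y,\mathbf 1]$; meets need not exist. For an implication algebra $\mathcal I$, $\mathsf I(\mathcal I)=\{\langle a,b\rangle : a,b\in\mathcal I,\ a\vee b=\mathbf 1,\ a\wedge b\text{ exists}\}$, ordered componentwise, with join $\langle a,b\rangle\vee\langle c,d\rangle=\langle a\vee c,b\vee d\rangle$, top $\langle\mathbf 1,\mathbf 1\rangle$, and for $\langle c,d\rangle\le\langle a,b\rangle$, $\Delta(\langle a,b\rangle,\langle c,d\rangle)=\langle a\wedge(b\to d),\,b\wedge(a\to c)\rangle$; this is a cubic algebra. A cubic algebra is a join-semilattice $\mathcal L$ with top $\mathbf 1$ and a binary operation $\Delta$ such that: if $x\le y$ then $\Delta(y,x)\vee x=y$; if $x\le y\le z$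 then $\Delta(z,\Delta(y,x))=\Delta(\Delta(z,y),\Delta(z,x))$; if $x\le y$ then $\Delta(y,\Delta(y,x))=x$; if $x\le y\le z$ then $\Delta(z,x)\le\Delta(z,y)$; and with $xy:=\Delta(\mathbf 1,\Delta(x\vee y,y))\vee y$ one has $(xy)y=x\vee y$ and $x(yz)=y(xz)$. In a cubic algebra, $a\sim b$ iff $\Delta(a\vee b,a)=b$; this is an equivalence relation, and $\mathcal L/\!\sim$ is an implication algebra with order $[a]\le[b]$ iff $\Delta(a\vee b,a)\le b$, join $[a]\vee[b]=[a\vee\Delta(a\vee b,b)]$ and implication $[a]\to[b]=[\Delta(a\vee b,a)\,b]$ (using the operation $xy$ above). *)

(* Defs.v *)
From HB Require Import structures.
From mathcomp Require Import all_boot all_order generic_quotient.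
From mathcomp Require Import boolp classical_sets.

Set Implicit Arguments.
Unset Strict Implicit.
Unset Printing Implicit Defensive.

Import Order.TTheory.
Local Open Scope order_scope.

Reserved Notation "x ~> y" (at level 55, right associativity).

(* The constant [itop] records that the carrier is nonempty; it is the common
   value of all [x ~> x]. *)
HB.mixin Record isImplicationAlgebra T of Choice T := {
  imp : T -> T -> T;
  itop : T;
  impxx : forall x, imp x x = itop;
  imp_contraction : forall x y, imp (imp x y) x = x;
  imp_quasicomm : forall x y, imp (imp x y) y = imp (imp y x) x;
  imp_exchange : forall x y z, imp x (imp y z) = imp y (imp x z)
}.

#[short(type="implicationAlgType")]
HB.structure Definition ImplicationAlgebra :=
  { T of Choice T & isImplicationAlgebra T }.

Notation "x ~> y" := (imp x y) : order_scope.

(* Isomorphisms of implication algebras. The top element is preserved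
   automatically, being [x ~> x]. *)
Definition imp_iso (I J : implicationAlgType) (f : I -> J) : Prop :=
  {morph f : x y / x ~> y >-> x ~> y} /\ bijective f.

Section ImplicationAlgebraOrder.
Variable I : implicationAlgType.
Implicit Types x y a b m : I.

Definition ile x y : bool := (x ~> y) == itop.

Definition ijoin x y : I := (x ~> y) ~> y.

Definition is_imeet a b m : Prop := forall x, ile x m = ile x a && ile x b.

Definition has_imeet a b : Prop := exists m, is_imeet a b m.

(* The meet of a and b when it exists, and a junk value otherwise. *)
Definition imeet a b : I := xget itop [set m | is_imeet a b m]%classic.

End ImplicationAlgebraOrder.

(* Two-valued homomorphisms separate points, which reduces inequalities in an
   implication algebra to truth tables. *)
Section TwoValued.
Variable I : implicationAlgType.
Implicit Types x y z a b c d m : I.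

Definition val2 (h : I -> bool) : Prop :=
  forall x y, h (x ~> y) = (h x ==> h y).

Lemma imp1x x : itop ~> x = x.
Proof. by rewrite -(impxx x) imp_contraction. Qed.

Lemma impx1 x : x ~> itop = itop.
Proof. by have := imp_contraction itop x; rewrite imp1x. Qed.

Lemma ile_antiE x y : x ~> y = itop -> y ~> x = itop -> x = y.
Proof. by move=> xy yx; move: (imp_quasicomm x y); rewrite xy yx !imp1x. Qed.

Lemma imp_weaken x y : x ~> (y ~> x) = itop.
Proof. by rewrite imp_exchange impxx impx1. Qed.

Lemma imp_mono_r a x y : x ~> y = itop -> (a ~> x) ~> (a ~> y) = itop.
Proof.
move=> xy; have -> : y = (y ~> x) ~> x by rewrite -imp_quasicomm xy imp1x.
by rewrite (imp_exchange a) imp_weaken.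
Qed.

Lemma imp_mp a b : a ~> ((a ~> b) ~> b) = itop.
Proof. by rewrite imp_exchange impxx. Qed.

Lemma imp_prefix a b c : (a ~> b) ~> ((c ~> a) ~> (c ~> b)) = itop.
Proof.
rewrite imp_exchange [(a ~> b) ~> _]imp_exchange.
by apply: imp_mono_r; apply: imp_mp.
Qed.

Lemma ile_transE x y z : x ~> y = itop -> y ~> z = itop -> x ~> z = itop.
Proof. by move=> xy /(imp_mono_r x); rewrite xy imp1x. Qed.

Lemma imp_suffix a b c : (a ~> b) ~> ((b ~> c) ~> (a ~> c)) = itop.
Proof. by rewrite imp_exchange imp_prefix. Qed.

Lemma imp_cases a x y : ((x ~> y) ~> a) ~> ((x ~> a) ~> a) = itop.
Proof.
have := imp_suffix (x ~> y) a x.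
by rewrite imp_contraction -imp_quasicomm.
Qed.

Local Definition mp (X : set I) : Prop :=
  forall x y, X x -> X (x ~> y) -> X y.

Lemma impK_distr w x y : (w ~> (x ~> y)) ~> ((w ~> x) ~> (w ~> y)) = itop.
Proof.
have c : w ~> (w ~> y) = w ~> y.
  apply: ile_antiE; last exact: imp_weaken.
  by rewrite imp_quasicomm imp_contraction impxx.
have := imp_prefix x (w ~> y) w; rewrite c.
by rewrite [x ~> _]imp_exchange.
Qed.

Lemma val2_sep a : a <> itop -> exists2 h, val2 h & h a = false.
Proof.
move=> a1.
pose F1 (X : set I) : set I := [set z | z = itop \/ X z]%classic.
pose P (X : set I) : Prop := mp (F1 X) /\ ~ F1 X a.
have [F FP totF|X [[Xmp Xa] Xmax]] := @Zorn_bigcup I P.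
  split; last first.
    by case=> [//|[X /FP[_ Xa] Fa]]; apply: Xa; right.
  have U X z : F X -> F1 X z -> F1 (\bigcup_(X in F) X)%classic z.
    by move=> FX [->|Xz]; [left|right; exists X].
  move=> x y [->|[X FX Xx]]; first by rewrite imp1x.
  case=> [xy|[Y FY Yxy]].
    by apply: (U X y FX); apply: (FP X FX).1 (or_intror Xx) (or_introl xy).
  have [XY|YX] := totF X Y FX FY.
    by apply: (U Y y FY); apply: (FP Y FY).1 (or_intror (XY _ Xx)) (or_intror Yxy).
  by apply: (U X y FX); apply: (FP X FX).1 (or_intror Xx) (or_intror (YX _ Yxy)).
have up x y : x ~> y = itop -> F1 X x -> F1 X y.
  by move=> xy Xx; apply: Xmp Xx _; left.
have ded x : ~ F1 X x -> F1 X (x ~> a).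
  move=> Xx; apply: contrapT => Xxa.
  apply: (Xmax [set z | F1 X (x ~> z)]%classic).
    split; last by move=> H; apply: Xx; right; apply: H => /=; left; rewrite impxx.
    by move=> z Xz /=; apply: up (imp_weaken z x) _; right.
  have FE z : F1 [set z | F1 X (x ~> z)]%classic z -> F1 X (x ~> z).
    by case=> [->|//]; rewrite impx1; left.
  split; last by move/FE.
  move=> u v /FE Xu /FE Xuv; right => /=.
  apply: Xmp Xu _; apply: up (impK_distr x u v) Xuv.
exists (fun z => `[< F1 X z >]); last by apply/asboolPn.
move=> x y; apply/asboolP/implyP => [Xxy /asboolP Xx|H].
  by apply/asboolP/(Xmp x).
have [Xx|Xx] := pselect (F1 X x).
  by move/asboolP/H/asboolP: Xx; apply: up; apply: imp_weaken.
apply: contrapT => /ded Xxy; apply: Xa.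
by apply: (Xmp _ _ (ded _ Xx)); apply: up Xxy; apply: imp_cases.
Qed.

Lemma val2_top h : val2 h -> h itop.
Proof. by move=> hh; rewrite -(impxx itop) hh implybb. Qed.

Lemma val2_join h x y : val2 h -> h (ijoin x y) = h x || h y.
Proof. by move=> hh; rewrite /ijoin !hh; case: (h x); case: (h y). Qed.

Lemma ileP x y : reflect (forall h, val2 h -> h x -> h y) (ile x y).
Proof.
apply: (iffP eqP) => [xy h hh|H].
  by have := val2_top hh; rewrite -xy hh => /implyP.
apply: contrapT => /val2_sep[h hh].
by rewrite hh => /negbT/negP; apply; apply/implyP/H.
Qed.

Lemma val2_eq x y : (forall h, val2 h -> h x = h y) -> x = y.
Proof.
by move=> H; apply: ile_antiE; apply/eqP/ileP => h /H ->.
Qed.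

Lemma ilexx x : ile x x. Proof. by apply/eqP; apply: impxx. Qed.

Lemma ile_anti x y : ile x y -> ile y x -> x = y.
Proof. by move=> /eqP xy /eqP; apply: ile_antiE. Qed.

Lemma ile_trans y x z : ile x y -> ile y z -> ile x z.
Proof. by move=> /ileP xy /ileP yz; apply/ileP => h hh /xy-/(_ hh)/yz; apply. Qed.

(* Two elements with a common lower bound m have a meet. *)
Lemma lb_is_imeet a b m : ile m a -> ile m b ->
  is_imeet a b ((a ~> (b ~> m)) ~> m).
Proof.
move=> /ileP ma /ileP mb x; apply/ileP/andP => [H|[/ileP xa /ileP xb] h hh hx].
  split; apply/ileP => h hh hx; have := H h hh hx; move: (ma h hh) (mb h hh);
  by rewrite !hh; case: (h m) => [-> // ->|_ _] //; case: (h a); case: (h b).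
by rewrite !hh xa // xb //; case: (h m).
Qed.

Lemma imeetP a b : has_imeet a b -> is_imeet a b (imeet a b).
Proof. exact: xgetPex. Qed.

Lemma imeet_unique a b m : is_imeet a b m -> imeet a b = m.
Proof.
move=> mP; have iP : has_imeet a b by exists m.
have := imeetP iP; set n := imeet a b => nP.
by apply: ile_anti; [rewrite mP -nP ilexx|rewrite nP -mP ilexx].
Qed.

Lemma val2_imeet h a b m : val2 h -> ile m a -> ile m b ->
  h (imeet a b) = h a && h b.
Proof.
move=> hh ma mb; rewrite (imeet_unique (lb_is_imeet ma mb)).
move: ma mb => /ileP/(_ h hh) ma /ileP/(_ h hh) mb.
by rewrite !hh; case: (h m) ma mb => [-> // ->|_ _] //; case: (h a); case: (h b).
Qed.

End TwoValued.

Local Ltac btaut :=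
  move=> *; repeat match goal with
  | H : is_true true -> _ |- _ => specialize (H isT)
  end; done.

(* The operation written as juxtaposition x y in a cubic algebra. *)
Definition cimp_of d (L : tJoinSemilatticeType d) (D : L -> L -> L) (x y : L) :=
  D \top (D (x `|` y) y) `|` y.

(* [Delta y x] matters only for x <= y; all axioms are restricted to that case. *)
HB.mixin Record isCubicAlgebra d T of Order.TJoinSemilattice d T := {
  Delta : T -> T -> T;
  Delta_join : forall x y : T, x <= y -> Delta y x `|` x = y;
  Delta_Delta : forall x y z : T, x <= y -> y <= z ->
    Delta z (Delta y x) = Delta (Delta z y) (Delta z x);
  Delta_invol : forall x y : T, x <= y -> Delta y (Delta y x) = x;
  Delta_mono : forall x y z : T, x <= y -> y <= z -> Delta z x <= Delta z y;
  cimp_of_join : forall x y : T,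
    cimp_of Delta (cimp_of Delta x y) y = x `|` y;
  cimp_of_exchange : forall x y z : T,
    cimp_of Delta x (cimp_of Delta y z) = cimp_of Delta y (cimp_of Delta x z)
}.

#[short(type="cubicAlgType")]
HB.structure Definition CubicAlgebra d :=
  { T of Order.TJoinSemilattice d T & isCubicAlgebra d T }.

Arguments Delta_join {d s} [x y].
Arguments Delta_Delta {d s} [x y z].
Arguments Delta_invol {d s} [x y].
Arguments Delta_mono {d s} [x y z].

Section CubicAlgebra.
Context {d : Order.disp_t} {L : cubicAlgType d}.
Implicit Types a b c e t u v w x y z : L.

Definition cimp x y : L := cimp_of Delta x y.

Lemma cimpE x y : cimp x y = Delta \top (Delta (x `|` y) y) `|` y.
Proof. by []. Qed.

Lemma Delta_le x y : x <= y -> Delta y x <= y.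
Proof. by move=> xy; rewrite -[leRHS](Delta_join xy) leUl. Qed.

Lemma Delta_leP x y z : x <= z -> y <= z -> (Delta z x <= y) = (x <= Delta z y).
Proof.
move=> xz yz; apply/idP/idP => H.
  by rewrite -(Delta_invol xz); apply: Delta_mono.
by rewrite -(Delta_invol yz); apply: Delta_mono => //; apply: Delta_le.
Qed.

Lemma DeltaU x y z : x <= z -> y <= z ->
  Delta z (x `|` y) = Delta z x `|` Delta z y.
Proof.
move=> xz yz; have xyz : x `|` y <= z by rewrite leUx xz.
have zz : Delta z x `|` Delta z y <= z by rewrite leUx !Delta_le.
apply/eqP; rewrite eq_le; apply/andP; split.
  by rewrite Delta_leP // leUx -!Delta_leP // leUl leUr.
by rewrite leUx !Delta_mono ?leUl ?leUr.
Qed.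

Lemma Deltaxx x : Delta x x = x.
Proof.
by apply/eqP; rewrite eq_le Delta_le //= -Delta_leP // Delta_le.
Qed.

Lemma cimpxx x : cimp x x = \top.
Proof. by rewrite cimpE joinxx Deltaxx Delta_join ?lex1. Qed.

Lemma cimp1x x : cimp \top x = x.
Proof. by rewrite cimpE (join_idPl (lex1 x)) Delta_invol ?lex1 // joinxx. Qed.

Lemma cimp_ge x y : y <= cimp x y. Proof. exact: leUr. Qed.

Lemma cimpUl x y : cimp (x `|` y) y = cimp x y.
Proof. by rewrite !cimpE -joinA joinxx. Qed.

Lemma cimpK x y : cimp (cimp x y) y = x `|` y. Proof. exact: cimp_of_join. Qed.

Lemma cimp_exchange x y z : cimp x (cimp y z) = cimp y (cimp x z).
Proof. exact: cimp_of_exchange. Qed.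

Lemma cimp_quasicomm x y : cimp (cimp x y) y = cimp (cimp y x) x.
Proof. by rewrite !cimpK joinC. Qed.

Lemma le_cimp x y : (x <= y) = (cimp x y == \top).
Proof.
apply/idP/eqP => [xy|xy]; first by rewrite -cimpUl (join_idPr xy) cimpxx.
by have := cimpK x y; rewrite xy cimp1x => ->; apply: leUl.
Qed.

Lemma cimpU1 x y : cimp x y `|` x = \top.
Proof.
have yu : y <= x `|` y by rewrite leUr.
apply/eqP; rewrite eq_le lex1 /= cimpE.
rewrite -[leLHS](@Delta_join _ _ (Delta (x `|` y) y)) ?lex1 //.
rewrite -joinA leUx leUl /=; apply: le_trans (Delta_le yu) _.
by rewrite [y `|` x]joinC leUr.
Qed.

Lemma cimp_contraction x y : cimp (cimp x y) x = x.
Proof.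
apply/eqP; rewrite eq_le cimp_ge andbT le_cimp cimpK.
by rewrite cimpU1.
Qed.

End CubicAlgebra.

Definition cubic_imp_alg d (L : cubicAlgType d) : Type := L.

HB.instance Definition _ d (L : cubicAlgType d) :=
  Choice.on (cubic_imp_alg L).
HB.instance Definition _ d (L : cubicAlgType d) :=
  isImplicationAlgebra.Build (cubic_imp_alg L)
    (@cimpxx d L) cimp_contraction cimp_quasicomm cimp_exchange.

Section CubicSimilarity.
Context {d : Order.disp_t} {L : cubicAlgType d}.
Implicit Types a b c e t u v w x y z : L.
Implicit Types h : L -> bool.

Local Notation cval2 h := (@val2 (cubic_imp_alg L) h).

Lemma c2imp h x y : cval2 h -> h (cimp x y) = (h x ==> h y).
Proof. exact. Qed.

Lemma c2U h x y : cval2 h -> h (x `|` y) = h x || h y.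
Proof. by move=> hh; rewrite -cimpK !c2imp //; case: (h x); case: (h y). Qed.

Lemma c2P x y : (forall h, cval2 h -> h x -> h y) -> x <= y.
Proof. by move=> /(ileP (x : cubic_imp_alg L)) H; rewrite le_cimp. Qed.

Lemma c2_le h x y : x <= y -> cval2 h -> h x -> h y.
Proof.
move=> xy hh; have : ile (x : cubic_imp_alg L) y by rewrite /ile -[_ == _]le_cimp.
by move/ileP; apply.
Qed.

Lemma c2_eq x y : (forall h, cval2 h -> h x = h y) -> x = y.
Proof. exact: (@val2_eq (cubic_imp_alg L)). Qed.

Lemma c2_top h : cval2 h -> h \top.
Proof. exact: (@val2_top (cubic_imp_alg L)). Qed.

Lemma Delta_Delta_le b u z : b <= u -> u <= z -> Delta z (Delta u b) <= cimp u b.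
Proof.
move=> bu uz; set w := Delta u b; set q := Delta z w.
have wu : w <= u by apply: Delta_le.
have wz : w <= z by apply: le_trans uz.
have qz : q <= z by apply: Delta_le.
have zw : cimp z w = Delta \top q `|` w by rewrite cimpE (join_idPl wz).
have uw : cimp u w = Delta \top b `|` w.
  by rewrite cimpE (join_idPl wu) [Delta u w]Delta_invol.
have ub : cimp u b = Delta \top w `|` b by rewrite cimpE (join_idPl bu).
have H : cimp z w <= cimp u w.
  by apply: c2P => h hh; rewrite !c2imp //; move: (c2_le uz hh); case: (h u) => [->|].
have : Delta \top (cimp z w) <= Delta \top (cimp u w) by apply: Delta_mono => //; apply: lex1.
rewrite zw uw !DeltaU ?lex1 // !Delta_invol ?lex1 // ub joinC [leRHS]joinC.
by rewrite leUx => /andP[].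
Qed.

(* Delta z (Delta u b) v b is the complement of u in [b, z]. *)
Definition rcomp b u z := Delta z (Delta u b) `|` b.

Lemma c2_rcomp h b u z : cval2 h -> b <= u -> u <= z ->
  h (rcomp b u z) = h z && (h u ==> h b).
Proof.
move=> hh bu uz; rewrite /rcomp; set q := Delta z _.
have wz : Delta u b <= z by apply: le_trans (Delta_le bu) uz.
have := c2_le (Delta_Delta_le bu uz) hh; rewrite -/q c2imp // c2U //.
have := c2_le (Delta_le wz) hh; rewrite -/q.
have : z <= q `|` u.
  by rewrite -(Delta_join wz) leUx leUl /= (le_trans (Delta_le bu)) ?leUr.
move/c2_le/(_ hh); rewrite c2U //.
move: (c2_le bu hh) (c2_le uz hh).
by case: (h q); case: (h z); case: (h u); case: (h b) => //=; btaut.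
Qed.

Lemma rcomp_ge b u z : b <= rcomp b u z. Proof. exact: leUr. Qed.

Lemma Delta_orth_le b u v : b <= u -> b <= v ->
  (forall h, cval2 h -> h u -> h v -> h b) ->
  Delta v b <= Delta (u `|` v) (Delta u b).
Proof.
move=> bu bv uvb; set z := u `|` v.
have uz : u <= z by rewrite leUl.
have vz : v <= z by rewrite leUr.
have bz : b <= z := le_trans bu uz.
have au : Delta u b <= u by apply: Delta_le.
have az : Delta u b <= z := le_trans au uz.
have cv : Delta v b <= v by apply: Delta_le.
have cz : Delta v b <= z := le_trans cv vz.
have cu : Delta z (Delta v b) <= u.
  apply: c2P => h hh hc; have : h (rcomp b v z) by rewrite c2U // hc.
  rewrite c2_rcomp // c2U //; move: (uvb h hh) (c2_le bu hh).
  by case: (h u); case: (h v); case: (h b) => //=; btaut.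
have vE : v = rcomp b u z.
  apply: c2_eq => h hh; rewrite c2_rcomp // c2U //.
  move: (uvb h hh) (c2_le bu hh) (c2_le bv hh).
  by case: (h u); case: (h v); case: (h b) => //=; btaut.
have vD : Delta z v = rcomp (Delta u b) u z.
  rewrite {1}vE /rcomp DeltaU ?Delta_le // Delta_invol // joinC.
  by rewrite Delta_invol.
rewrite -Delta_leP //; apply: c2P => h hh hc.
have hu := c2_le cu hh hc.
have : h (Delta z v) by apply: c2_le hh hc; apply: Delta_mono.
by rewrite vD c2_rcomp // hu => /andP[].
Qed.

Lemma Delta_orth {b u v} : b <= u -> b <= v ->
  (forall h, cval2 h -> h u -> h v -> h b) ->
  Delta (u `|` v) (Delta u b) = Delta v b.
Proof.
move=> bu bv uvb; apply/eqP; rewrite eq_le Delta_orth_le // andbT.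
have cz : Delta v b <= u `|` v by rewrite (le_trans (Delta_le bv)) ?leUr.
have az : Delta u b <= u `|` v by rewrite (le_trans (Delta_le bu)) ?leUl.
rewrite Delta_leP // joinC; apply: Delta_orth_le => // h hh hv hu.
exact: uvb.
Qed.

Definition csim a b : bool := Delta (a `|` b) a == b.

Lemma csim_refl : reflexive csim.
Proof. by move=> a; rewrite /csim joinxx Deltaxx. Qed.

Lemma csim_Delta b u : b <= u -> csim b (Delta u b).
Proof. by move=> bu; rewrite /csim joinC Delta_join. Qed.

Lemma csimE a b : csim a b -> Delta (a `|` b) a = b.
Proof. by move/eqP. Qed.

Lemma csim_symmetric : symmetric csim.
Proof.
have S a b : csim a b -> csim b a.
  by move=> /csimE ab; rewrite /csim joinC -{2}ab Delta_invol ?leUl.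
by move=> a b; apply/idP/idP; apply: S.
Qed.

Lemma csim_chain b u z : b <= u -> u <= z -> csim (Delta u b) (Delta z b).
Proof.
move=> bu uz; have au := Delta_le bu; set a := Delta u b in au *.
have az := le_trans au uz.
have E : u `|` rcomp a u z = z.
  apply: c2_eq => h hh; rewrite c2U // c2_rcomp //.
  by move: (c2_le uz hh); case: (h u); case: (h z) => //= ->.
have := Delta_orth au (rcomp_ge a u z).
rewrite E Delta_invol // => ->; first by apply: csim_Delta; apply: rcomp_ge.
by move=> h hh hu; rewrite c2_rcomp // hu => /andP[].
Qed.

Lemma csim_orth b u v : b <= u -> b <= v ->
  (forall h, cval2 h -> h u -> h v -> h b) -> csim (Delta u b) (Delta v b).
Proof.
move=> bu bv uvb; rewrite -(Delta_orth bu bv uvb); apply: csim_Delta.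
by rewrite (le_trans (Delta_le bu)) ?leUl.
Qed.

Lemma csim_base b u v : b <= u -> b <= v -> csim (Delta u b) (Delta v b).
Proof.
move=> bu bv; pose m := cimp (cimp u (cimp v b)) b.
have hm h : cval2 h -> h m = h u && h v.
  move=> hh; rewrite !c2imp //; move: (c2_le bu hh) (c2_le bv hh).
  by case: (h u); case: (h v); case: (h b) => //=; btaut.
have bm : b <= m by apply: cimp_ge.
have mu : m <= u by apply: c2P => h hh; rewrite hm // => /andP[].
have mv : m <= v by apply: c2P => h hh; rewrite hm // => /andP[].
have dm := Delta_le bm; set e := Delta m b in dm.
have ea : csim e (Delta u b) by apply: csim_chain.
have ec : csim e (Delta v b) by apply: csim_chain.
have eb : Delta m e = b by apply: Delta_invol.
have eu : e `|` Delta u b = rcomp e m u by rewrite /rcomp eb joinC.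
have ev : e `|` Delta v b = rcomp e m v by rewrite /rcomp eb joinC.
rewrite -(csimE ea) -(csimE ec); apply: csim_orth; rewrite ?leUl // => h hh.
rewrite eu ev (c2_rcomp hh dm mu) (c2_rcomp hh dm mv) => /andP[hu hme] /andP[hv _].
by move: hme; rewrite hm // hu hv.
Qed.

Lemma csim_transitive : transitive csim.
Proof.
move=> b a c; rewrite csim_symmetric => ab bc.
by rewrite -(csimE ab) -(csimE bc); apply: csim_base; apply: leUl.
Qed.

(* The preorder on L that induces the order of the quotient. *)
Definition cple a b : bool := Delta (a `|` b) a <= b.

Lemma csim_cple a a' x : csim a' a -> a' <= x -> cple a x.
Proof.
move=> aa' a'x; rewrite /cple; set z := a `|` x; set t := a' `|` a.
have tz : t <= z by rewrite leUx leUl (le_trans a'x) ?leUr.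
have a't : a' <= t by rewrite leUl.
have hv h : cval2 h -> h (rcomp a' t z) = h z && (h t ==> h a').
  by move=> hh; apply: c2_rcomp.
have vx : rcomp a' t z <= x.
  apply: c2P => h hh; rewrite hv // !c2U //; move: (c2_le a'x hh).
  by case: (h a); case: (h x); case: (h a') => //= ->.
have E : t `|` rcomp a' t z = z.
  apply: c2_eq => h hh; rewrite c2U // hv //.
  by move: (c2_le tz hh); case: (h t); case: (h z) => //= ->.
have := Delta_orth a't (rcomp_ge a' t z).
rewrite E [Delta t a'](csimE aa') => ->.
  by apply: le_trans vx; apply: Delta_le; apply: rcomp_ge.
by move=> h hh ht; rewrite hv // ht => /andP[].
Qed.

Lemma cpleP a x : reflect (exists2 a', csim a a' & a' <= x) (cple a x).
Proof.
apply: (iffP idP) => [ax|[a' aa' a'x]]; last first.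
  by apply: csim_cple a'x; rewrite csim_symmetric.
by exists (Delta (a `|` x) a) => //; apply: csim_Delta; apply: leUl.
Qed.

Lemma le_cple a b : a <= b -> cple a b.
Proof. by move=> ab; apply/cpleP; exists a => //; apply: csim_refl. Qed.

Lemma csim_le_cple a b : csim a b -> cple a b.
Proof. by move=> ab; apply/cpleP; exists b. Qed.

Lemma cple_trans : transitive cple.
Proof.
move=> y x z /cpleP[x' xx' x'y] /cpleP[y' yy' y'z]; apply/cpleP.
exists (Delta (y `|` y') x'); last first.
  by apply: le_trans y'z; rewrite -[leRHS](csimE yy') Delta_mono ?leUl.
apply: csim_transitive xx' _; apply: csim_Delta.
by apply: le_trans x'y _; apply: leUl.
Qed.

Definition cjoin a b := Delta (a `|` b) a `|` b.

Lemma cjoin_min a b x : cple a x -> b <= x -> cjoin a b <= x.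
Proof.
move=> ax bx; rewrite /cjoin leUx bx andbT; move: ax; rewrite /cple.
set z := a `|` x; set u := a `|` b; set e := Delta u a => ax.
have az : a <= z by rewrite leUl.
have xz : x <= z by rewrite leUr.
have uz : u <= z by rewrite leUx az (le_trans bx).
have au : a <= u by rewrite leUl.
have ez : e <= z by rewrite (le_trans (Delta_le au)).
have ay : a <= Delta z x by rewrite -Delta_leP.
have yb : z <= Delta z x `|` b.
  rewrite -[leLHS](Delta_join (le_trans bx xz)) leUx leUr andbT.
  by apply: (le_trans _ (leUl _ _)); apply: Delta_mono.
have vy : rcomp a u z <= Delta z x.
  apply: c2P => h hh; rewrite c2_rcomp //.
  move: (c2_le yb hh) (c2_le ay hh); rewrite (c2U (Delta z x) b hh) /u (c2U a b hh).
  by case: (h (Delta z x)); case: (h a); case: (h z); case: (h b) => //=; btaut.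
rewrite -[x](Delta_invol xz) -Delta_leP ?Delta_le //.
by apply: le_trans vy; apply: leUl.
Qed.

Lemma cple_cjoinl a b : cple a (cjoin a b).
Proof.
apply/cpleP; exists (Delta (a `|` b) a); last exact: leUl.
by apply: csim_Delta; apply: leUl.
Qed.

Lemma cjoin_ger a b : b <= cjoin a b. Proof. exact: leUr. Qed.

(* Below a common lower bound, the preorder is the order. *)
Lemma cple_le c a x : c <= a -> c <= x -> cple a x -> a <= x.
Proof.
move=> ca cx ax; apply: le_trans (cjoin_min ax cx).
by rewrite /cjoin (join_idPl ca) Deltaxx leUl.
Qed.

Lemma cple_anti a b : cple a b -> cple b a -> csim a b.
Proof.
move=> /cpleP[a' aa' a'b] ba.
have /(cple_le a'b (lexx _)) ba' : cple b a'.
  by apply: cple_trans ba _; apply: csim_le_cple.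
by have <- : a' = b by apply/eqP; rewrite eq_le a'b.
Qed.

Lemma cple_lift b w : cple b w -> exists2 w', csim w w' & b <= w'.
Proof.
move=> bw; exists (Delta (b `|` w) w).
  by apply: csim_Delta; apply: leUr.
by rewrite -Delta_leP ?leUl ?leUr.
Qed.

Lemma cjoin_lub a b w : cple (cjoin a b) w = cple a w && cple b w.
Proof.
apply/idP/andP => [H|[aw bw]].
  split; first exact: cple_trans (cple_cjoinl _ _) H.
  by apply: cple_trans H; apply/le_cple/cjoin_ger.
have [w' ww' bw'] := cple_lift bw.
apply/cpleP; apply/cpleP; apply: (@cple_trans w'); last first.
  by apply: csim_le_cple; rewrite csim_symmetric.
apply/le_cple/cjoin_min => //; apply: cple_trans aw _; exact: csim_le_cple.
Qed.

Definition cqimp a b := cimp (Delta (a `|` b) a) b.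

Lemma cqimpE a b : cqimp a b = cimp (cjoin a b) b.
Proof. by rewrite /cqimp -cimpUl. Qed.

Lemma cqimp_ge a b : b <= cqimp a b. Proof. exact: cimp_ge. Qed.

Lemma cqimp_cojoin a b w : cple a w -> cple (cqimp a b) w -> cple \top w.
Proof.
move=> aw yw; have bw : cple b w by apply: cple_trans yw; apply/le_cple/cqimp_ge.
have [w' ww' bw'] := cple_lift bw.
have W t : cple t w -> cple t w' by move=> H; apply: cple_trans H (csim_le_cple ww').
have jw' := cjoin_min (W _ aw) bw'.
have yw' := cple_le (cqimp_ge a b) bw' (W _ yw).
apply: (@cple_trans w'); last by apply: csim_le_cple; rewrite csim_symmetric.
apply/le_cple/c2P => h hh _; move: (c2_le jw' hh) (c2_le yw' hh).
by rewrite cqimpE c2imp //; case: (h (cjoin a b)) => /= [|_]; auto.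
Qed.

Lemma cqimp_least a b y : cple b y ->
  (forall w, cple a w -> cple y w -> cple \top w) -> cple (cqimp a b) y.
Proof.
move=> /cple_lift[y' yy' by'] H.
apply: (@cple_trans y'); last by apply: csim_le_cple; rewrite csim_symmetric.
have T1 : \top <= y' `|` cjoin a b.
  apply: (@cple_le (y' `|` cjoin a b)); rewrite ?lex1 //; apply: H.
    by apply: cple_trans (cple_cjoinl a b) _; apply/le_cple/leUr.
  by apply: cple_trans (csim_le_cple yy') _; apply/le_cple/leUl.
apply/le_cple/c2P => h hh; rewrite cqimpE c2imp //.
have := c2_le T1 hh (c2_top hh); rewrite c2U // => /orP[//|->] /=.
exact: c2_le.
Qed.

Lemma cqimp_cple a a' b b' : (forall w, cple b w -> cple a w = cple a' w) ->
  csim b b' -> cple (cqimp a b) (cqimp a' b').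
Proof.
move=> aa' bb'.
have bb : cple b (cqimp a' b').
  by apply: cple_trans (csim_le_cple bb') _; apply/le_cple/cqimp_ge.
apply: cqimp_least => // w aw yw; apply: (@cqimp_cojoin a' b') => //.
by rewrite -aa' //; apply: cple_trans yw.
Qed.

Lemma cqimp_csim a a' b b' : (forall w, cple b w -> cple a w = cple a' w) ->
  csim b b' -> csim (cqimp a b) (cqimp a' b').
Proof.
move=> aa' bb'; apply: cple_anti; apply: cqimp_cple => //.
  move=> w bw; rewrite aa' //; apply: cple_trans bw; exact: csim_le_cple.
by rewrite csim_symmetric.
Qed.

Lemma csim_cpleE a a' w : csim a a' -> cple a w = cple a' w.
Proof.
move=> aa'; apply/idP/idP; apply: cple_trans; apply: csim_le_cple => //.
by rewrite csim_symmetric.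
Qed.

Lemma cqimp_compat a a' b b' : csim a a' -> csim b b' ->
  csim (cqimp a b) (cqimp a' b').
Proof. by move=> aa'; apply: cqimp_csim => w _; apply: csim_cpleE. Qed.

(* When a and b have a lower bound, cqimp a b is a b. *)
Lemma cqimp_lb c a b : c <= a -> c <= b -> cqimp a b = cimp a b.
Proof.
move=> ca cb; rewrite cqimpE -[RHS]cimpUl; congr cimp.
apply/eqP; rewrite eq_le; apply/andP; split.
  by apply: cjoin_min; rewrite ?leUr //; apply/le_cple/leUl.
rewrite leUx cjoin_ger andbT.
apply: (cple_le ca _ (cple_cjoinl a b)).
by apply: le_trans cb _; apply: cjoin_ger.
Qed.

Lemma cqimp_cjoin a b c : c <= b ->
  csim (cqimp a b) (cimp (cjoin a c) b).
Proof.
move=> cb; rewrite -(@cqimp_lb c) ?cjoin_ger //.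
apply: cqimp_csim; last exact: csim_refl.
move=> w bw; rewrite cjoin_lub; case: (cple a w) => //=.
by rewrite (cple_trans (le_cple cb)).
Qed.

Lemma cjoinC a b : csim (cjoin a b) (cjoin b a).
Proof.
have H x y : cple (cjoin x y) (cjoin y x).
  by rewrite cjoin_lub cple_cjoinl andbT; apply/le_cple/cjoin_ger.
by apply: cple_anti.
Qed.

End CubicSimilarity.

Canonical csim_equiv d (L : cubicAlgType d) :=
  EquivRel (@csim d L) csim_refl csim_symmetric csim_transitive.

(* The quotient of a cubic algebra by its similarity relation. *)
Definition cubic_quot d (L : cubicAlgType d) : Type :=
  {eq_quot (@csim d L)}%qT.

Section CubicQuotient.
Context {d : Order.disp_t} {L : cubicAlgType d}.
Local Open Scope quotient_scope.

HB.instance Definition _ := Choice.on (cubic_quot L).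
HB.instance Definition _ := EqQuotient.on (cubic_quot L).

Local Notation Q := (cubic_quot L).

Definition quot_imp : Q -> Q -> Q := lift_op2 Q cqimp.

Definition quot_top : Q := \pi_Q \top.

Lemma pi_cqimp (a b : L) :
  quot_imp (\pi_Q a) (\pi_Q b) = \pi_Q (cimp (Delta (a `|` b) a) b).
Proof.
rewrite /quot_imp -lock; apply/eqmodP; apply: cqimp_compat.
  by apply/eqmodP; rewrite reprK.
by apply/eqmodP; rewrite reprK.
Qed.

Lemma quot_cjoin a b :
  quot_imp (quot_imp (\pi_Q a) (\pi_Q b)) (\pi_Q b) = \pi_Q (cjoin a b).
Proof.
rewrite pi_cqimp -/(cqimp a b) cqimpE pi_cqimp.
rewrite -/(cqimp _ b) (@cqimp_lb _ _ b) ?cimp_ge // cimpK.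
by rewrite (join_idPl (cjoin_ger a b)).
Qed.

Lemma quot_impxx x : quot_imp x x = quot_top.
Proof.
elim/quotP: x => a _; rewrite pi_cqimp; apply/eqmodP.
by rewrite /= -/(cqimp a a) (@cqimp_lb _ _ a) // cimpxx; apply: csim_refl.
Qed.

Lemma quot_imp_contraction x y : quot_imp (quot_imp x y) x = x.
Proof.
elim/quotP: x => a _; elim/quotP: y => b _; rewrite !pi_cqimp; apply/eqmodP.
apply: cple_anti; last exact/le_cple/cqimp_ge.
by apply: cqimp_least; [apply: le_cple|move=> w yw aw; apply: cqimp_cojoin yw].
Qed.

Lemma quot_imp_quasicomm x y :
  quot_imp (quot_imp x y) y = quot_imp (quot_imp y x) x.
Proof.
elim/quotP: x => a _; elim/quotP: y => b _; rewrite !quot_cjoin.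
apply/eqmodP; exact: cjoinC.
Qed.

Lemma quot_imp_exchange x y z :
  quot_imp x (quot_imp y z) = quot_imp y (quot_imp x z).
Proof.
elim/quotP: x => a _; elim/quotP: y => b _; elim/quotP: z => c _.
have H a' b' : quot_imp (\pi_Q a') (quot_imp (\pi_Q b') (\pi_Q c)) =
    \pi_Q (cimp (cjoin a' c) (cimp (cjoin b' c) c)).
  rewrite pi_cqimp -/(cqimp b' c) cqimpE pi_cqimp; apply/eqmodP.
  by apply: cqimp_cjoin; apply: cimp_ge.
by rewrite !H cimp_exchange.
Qed.

HB.instance Definition _ := isImplicationAlgebra.Build (cubic_quot L)
  quot_impxx quot_imp_contraction quot_imp_quasicomm quot_imp_exchange.

Definition cubic_eta (a : L) : Q := \pi_Q a.

Lemma eta_eq a b : (cubic_eta a = cubic_eta b) <-> Delta (a `|` b) a = b.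
Proof.
by split=> [/eqmodP/eqP|ab] //; apply/eqmodP/eqP.
Qed.

Lemma eta_imp a b :
  cubic_eta a ~> cubic_eta b = cubic_eta (cimp (Delta (a `|` b) a) b).
Proof. exact: pi_cqimp. Qed.

Lemma eta_join a b :
  ijoin (cubic_eta a) (cubic_eta b) = cubic_eta (a `|` Delta (a `|` b) b).
Proof.
rewrite /ijoin [LHS]quot_cjoin; apply/eqmodP.
by rewrite [a `|` Delta _ _]joinC [a `|` b]joinC; apply: cjoinC.
Qed.

Lemma eta_ile a b :
  ile (cubic_eta a) (cubic_eta b) = (Delta (a `|` b) a <= b).
Proof.
have E : cple a b = (cple \top (cqimp a b)).
  apply/idP/idP => [ab|H].
    have jb := cjoin_min ab (lexx b).
    by rewrite cqimpE; move: jb; rewrite le_cimp => /eqP ->; apply: le_cple.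
  apply: (@cple_trans _ _ (cjoin a b)); first exact: cple_cjoinl.
  apply: le_cple; rewrite le_cimp -cqimpE eq_le lex1 /=.
  by apply: (@cple_le _ _ (cqimp a b)) H; rewrite ?lex1.
rewrite -/(cple a b) E /ile eta_imp; apply/eqP/idP => [/eqmodP H|H].
  by apply: csim_le_cple; rewrite csim_symmetric.
by apply/eqmodP; apply: cple_anti => //; apply/le_cple/lex1.
Qed.

End CubicQuotient.

Section IntervalAlgebra.
Variable I : implicationAlgType.

Definition interval_pred (p : I * I) : bool :=
  `[< ijoin p.1 p.2 = itop /\ has_imeet p.1 p.2 >].

(* The pairs <a, b> with a v b = 1 such that the meet of a and b exists. *)
Record interval_alg := IntervalAlg {
  interval_val :> I * I;
  _ : interval_pred interval_val
}.

HB.instance Definition _ := [isSub for interval_val].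
HB.instance Definition _ := [Choice of interval_alg by <:].

Implicit Types p q r : interval_alg.
Implicit Types h : I -> bool.

Lemma interval_predP (p : I * I) :
  interval_pred p <->
  (forall h, val2 h -> h p.1 || h p.2) /\ (exists2 m, ile m p.1 & ile m p.2).
Proof.
split=> [/asboolP[j1 [m mP]]|[H [m m1 m2]]].
  split=> [h hh|]; first by rewrite -val2_join // j1 val2_top.
  by exists m; move: (mP m); rewrite ilexx => /esym/andP[].
apply/asboolP; split; last by exists ((p.1 ~> p.2 ~> m) ~> m); apply: lb_is_imeet.
by apply: val2_eq => h hh; rewrite val2_join // H // val2_top.
Qed.

Definition interval_le p q : bool := ile p.1 q.1 && ile p.2 q.2.

Lemma interval_le_refl : reflexive interval_le.
Proof. by move=> p; rewrite /interval_le !ilexx. Qed.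

Lemma interval_le_anti : antisymmetric interval_le.
Proof.
move=> p q /andP[/andP[p1 p2] /andP[q1 q2]]; apply: val_inj => /=.
rewrite [interval_val p]surjective_pairing [interval_val q]surjective_pairing.
by congr (_, _); apply: ile_anti.
Qed.

Lemma interval_le_trans : transitive interval_le.
Proof.
move=> q p r /andP[p1 p2] /andP[q1 q2].
by apply/andP; split; [apply: ile_trans p1 q1|apply: ile_trans p2 q2].
Qed.

Fact interval_display : Order.disp_t. Proof. exact: Order.Disp tt tt. Qed.

HB.instance Definition _ := Order.Le_isPOrder.Build interval_display
  interval_alg interval_le_refl interval_le_anti interval_le_trans.

Lemma interval_leE p q : (p <= q) = ile p.1 q.1 && ile p.2 q.2.
Proof. by []. Qed.

Lemma interval_or p h : val2 h -> h p.1 || h p.2.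
Proof. by move=> hh; have /interval_predP[H _] := valP p; apply: H. Qed.

Lemma interval_lb p : exists2 m, ile m p.1 & ile m p.2.
Proof. by have /interval_predP[] := valP p. Qed.

Fact interval_join_subproof p q :
  interval_pred (ijoin p.1 q.1, ijoin p.2 q.2).
Proof.
apply/interval_predP; split=> /= [h hh|].
  by rewrite !val2_join //; case/orP: (interval_or p hh) => ->; rewrite ?orbT.
have [m /ileP m1 /ileP m2] := interval_lb p; exists m; apply/ileP => h hh hm.
  by rewrite val2_join // m1.
by rewrite val2_join // m2.
Qed.

Definition interval_join p q : interval_alg :=
  IntervalAlg (interval_join_subproof p q).

Lemma ijoin_ile (x y z : I) : ile (ijoin x y) z = ile x z && ile y z.
Proof.
apply/ileP/andP => [H|[/ileP xz /ileP yz] h hh].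
  by split; apply/ileP => h hh hx; apply: H => //; rewrite val2_join // hx ?orbT.
by rewrite val2_join // => /orP[/xz|/yz]; apply.
Qed.

Lemma interval_joinP p q r :
  (interval_join p q <= r) = (p <= r) && (q <= r).
Proof. by rewrite !interval_leE /= !ijoin_ile andbACA. Qed.

HB.instance Definition _ := Order.POrder_isJoinSemilattice.Build
  interval_display interval_alg interval_joinP.

Fact interval_embed_subproof (x : I) : interval_pred (itop, x).
Proof.
apply/interval_predP; split=> /= [h hh|]; first by rewrite val2_top.
by exists x; [apply/ileP => h hh _; apply: val2_top|apply: ilexx].
Qed.

Definition interval_embed (x : I) : interval_alg :=
  IntervalAlg (interval_embed_subproof x).

Lemma interval_lex1 p : p <= interval_embed itop.
Proof.
by rewrite interval_leE; apply/andP; split; apply/ileP => h hh _; apply: val2_top.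
Qed.

HB.instance Definition _ := Order.hasTop.Build interval_display interval_alg
  interval_lex1.

Definition interval_Delta_pair (p q : I * I) : I * I :=
  (imeet p.1 (p.2 ~> q.2), imeet p.2 (p.1 ~> q.1)).

(* For q <= p the pair lies in I(I), see [interval_DeltaE]; otherwise
   the value may be the junk value p. *)
Definition interval_Delta p q : interval_alg :=
  insubd p (interval_Delta_pair p q).

Lemma interval_le2 p q h : q <= p -> val2 h ->
  (h q.1 -> h p.1) /\ (h q.2 -> h p.2).
Proof. by move=> /andP[/ileP H1 /ileP H2] hh; split; [apply: H1|apply: H2]. Qed.

Lemma interval_Delta_lb p q m : q <= p -> ile m q.1 -> ile m q.2 ->
  [/\ ile m p.1, ile m (p.2 ~> q.2), ile m p.2 & ile m (p.1 ~> q.1)].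
Proof.
move=> /andP[q1 q2] m1 m2; split.
- exact: ile_trans q1.
- by move/ileP: m2 => m2; apply/ileP => h hh hm; rewrite hh m2 ?implybT.
- exact: ile_trans q2.
- by move/ileP: m1 => m1; apply/ileP => h hh hm; rewrite hh m1 ?implybT.
Qed.

Lemma val2_Delta_pair h p q : q <= p -> val2 h ->
  h (interval_Delta_pair p q).1 = h p.1 && (h p.2 ==> h q.2) /\
  h (interval_Delta_pair p q).2 = h p.2 && (h p.1 ==> h q.1).
Proof.
move=> qp hh; have [m m1 m2] := interval_lb q.
have [p1 i1 p2 i2] := interval_Delta_lb qp m1 m2.
by split; rewrite (@val2_imeet _ h _ _ m) // hh.
Qed.

(* The meets in the definition of Delta exist. *)
Lemma interval_Delta_has_imeet p q : q <= p ->
  has_imeet p.1 (p.2 ~> q.2) /\ has_imeet p.2 (p.1 ~> q.1).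
Proof.
move=> qp; have [m m1 m2] := interval_lb q.
have [p1 i1 p2 i2] := interval_Delta_lb qp m1 m2.
by split; eexists; apply: (lb_is_imeet (m := m)).
Qed.

Lemma interval_DeltaE p q : q <= p ->
  interval_Delta p q = interval_Delta_pair p q :> I * I.
Proof.
move=> qp; apply: (@insubdK _ interval_pred); apply/interval_predP; split=> [h hh|].
  have [-> ->] := val2_Delta_pair qp hh.
  have := interval_or p hh; have := interval_or q hh.
  have [] := interval_le2 qp hh.
  by case: (h p.1); case: (h p.2); case: (h q.1); case: (h q.2) => //= *; btaut.
have [m m1 m2] := interval_lb q.
have [/ileP p1 /ileP i1 /ileP p2 /ileP i2] := interval_Delta_lb qp m1 m2.
exists m; apply/ileP => h hh hm; have [D1 D2] := val2_Delta_pair qp hh.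
  by rewrite D1 p1 // -hh i1.
by rewrite D2 p2 // -hh i2.
Qed.

Lemma val2_Delta h p q : q <= p -> val2 h ->
  (h (interval_Delta p q).1 = h p.1 && (h p.2 ==> h q.2)) *
  (h (interval_Delta p q).2 = h p.2 && (h p.1 ==> h q.1)).
Proof.
by move=> qp hh; rewrite interval_DeltaE //; have [-> ->] := val2_Delta_pair qp hh.
Qed.

Lemma interval_eq p q :
  (forall h, val2 h -> h p.1 = h q.1 /\ h p.2 = h q.2) -> p = q.
Proof.
move=> H; apply: interval_le_anti.
by apply/andP; split; apply/andP; split; apply/ileP => h /H[E1 E2];
  rewrite ?E1 ?E2.
Qed.

Lemma interval_leP p q :
  (forall h, val2 h -> (h p.1 -> h q.1) /\ (h p.2 -> h q.2)) -> p <= q.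
Proof. by move=> H; apply/andP; split; apply/ileP => h /H[]. Qed.

Lemma val2_joinE h p q : val2 h ->
  (h (p `|` q).1 = h p.1 || h q.1) * (h (p `|` q).2 = h p.2 || h q.2).
Proof. by move=> hh; rewrite -!val2_join. Qed.

Lemma val2_topE h : val2 h ->
  (h (\top : interval_alg).1 = true) * (h (\top : interval_alg).2 = true).
Proof. by move=> hh; rewrite /= !val2_top. Qed.

Lemma interval_Delta_le x y : x <= y -> interval_Delta y x <= y.
Proof.
by move=> xy; apply: interval_leP => h hh; rewrite !(val2_Delta xy hh); split=> /andP[].
Qed.

Local Ltac bcases x h hh :=
  move: (interval_or x hh); case: (h x.1); case: (h x.2).

Lemma interval_Delta_join x y : x <= y -> interval_Delta y x `|` x = y.
Proof.
move=> xy; apply: interval_eq => h hh.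
rewrite !(val2_joinE _ _ hh) !(val2_Delta xy hh).
move: (interval_le2 xy hh) => [].
by bcases x h hh; bcases y h hh => //=; btaut.
Qed.

Lemma interval_Delta_mono x y z : x <= y -> y <= z ->
  interval_Delta z x <= interval_Delta z y.
Proof.
move=> xy yz; have xz := le_trans xy yz; apply: interval_leP => h hh.
rewrite !(val2_Delta xz hh) !(val2_Delta yz hh).
move: (interval_le2 xy hh) => [] H1 H2.
by split=> /andP[-> /implyP H]; apply/implyP => ?; auto.
Qed.

Lemma interval_Delta_Delta x y z : x <= y -> y <= z ->
  interval_Delta z (interval_Delta y x) =
  interval_Delta (interval_Delta z y) (interval_Delta z x).
Proof.
move=> xy yz; have xz := le_trans xy yz.
have yxz := le_trans (interval_Delta_le xy) yz.
have m := interval_Delta_mono xy yz.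
apply: interval_eq => h hh.
rewrite !(val2_Delta yxz hh) !(val2_Delta m hh) !(val2_Delta xy hh).
rewrite !(val2_Delta xz hh) !(val2_Delta yz hh).
move: (interval_le2 xy hh) (interval_le2 yz hh) => [] + + [].
by bcases x h hh; bcases y h hh; bcases z h hh => //=; btaut.
Qed.

Lemma interval_Delta_invol x y : x <= y -> interval_Delta y (interval_Delta y x) = x.
Proof.
move=> xy; have yx := interval_Delta_le xy.
apply: interval_eq => h hh; rewrite !(val2_Delta yx hh) !(val2_Delta xy hh).
move: (interval_le2 xy hh) => [].
by bcases x h hh; bcases y h hh => //=; btaut.
Qed.

Lemma val2_cimp h x y : val2 h ->
  let z := cimp_of interval_Delta x y in
  (h z.1 = (h x.1 ==> h y.1) && (h x.2 || h y.2 ==> h y.2) || h y.1) *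
  (h z.2 = (h x.2 ==> h y.2) && (h x.1 || h y.1 ==> h y.1) || h y.2).
Proof.
move=> hh z; rewrite /z /cimp_of !(val2_joinE _ _ hh).
rewrite !(val2_Delta (lex1 _) hh) !(val2_topE hh) !(val2_Delta (leUr _ _) hh).
rewrite !(val2_joinE _ _ hh).
by bcases x h hh; bcases y h hh.
Qed.

Lemma interval_cimp_join x y :
  cimp_of interval_Delta (cimp_of interval_Delta x y) y = x `|` y.
Proof.
apply: interval_eq => h hh; rewrite !(val2_cimp _ _ hh) !(val2_joinE _ _ hh).
by bcases x h hh; bcases y h hh.
Qed.

Lemma interval_cimp_exchange x y z :
  cimp_of interval_Delta x (cimp_of interval_Delta y z) =
  cimp_of interval_Delta y (cimp_of interval_Delta x z).
Proof.
apply: interval_eq => h hh; rewrite !(val2_cimp _ _ hh).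
by bcases x h hh; bcases y h hh; bcases z h hh.
Qed.

HB.instance Definition _ := isCubicAlgebra.Build interval_display interval_alg
  interval_Delta_join interval_Delta_Delta interval_Delta_invol
  interval_Delta_mono interval_cimp_join interval_cimp_exchange.

Definition iota : I -> cubic_quot interval_alg :=
  @cubic_eta _ interval_alg \o interval_embed.

End IntervalAlgebra.

(* Main.v *)
(* The class of <a, b> contains a unique pair with first component 1, namely
   <1, a /\ b> : since a \/ b = 1, reflecting it in <1, b> gives
   <b -> a /\ b, b> = <a, b>.  On representatives with first component 1 the
   implication of the quotient is already computed by
   <1, x> -> <1, y> = <1, x -> y>.  All identities are checked under two-valued
   homomorphisms. *)

From mathcomp Require Import all_boot all_order generic_quotient.
Require Import Defs.

Import Order.TTheory.

Section Embedding.
Set Implicit Arguments.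
Unset Strict Implicit.
Local Open Scope order_scope.
Variable I : implicationAlgType.
Implicit Types (x y : I) (p : interval_alg I).

Lemma val2_interval_Delta (h : I -> bool) (p q : interval_alg I) :
  q <= p -> val2 h ->
  (h (Delta p q).1 = h p.1 && (h p.2 ==> h q.2)) *
  (h (Delta p q).2 = h p.2 && (h p.1 ==> h q.1)).
Proof. exact: val2_Delta. Qed.

Lemma val2_interval_cimp (h : I -> bool) (p q : interval_alg I) : val2 h ->
  (h (cimp p q).1 = (h p.1 ==> h q.1) && (h p.2 || h q.2 ==> h q.2) || h q.1) *
  (h (cimp p q).2 = (h p.2 ==> h q.2) && (h p.1 || h q.1 ==> h q.1) || h q.2).
Proof. exact: val2_cimp. Qed.

Lemma val2_interval_embed (h : I -> bool) x : val2 h ->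
  (h (interval_embed x).1 = true) * (h (interval_embed x).2 = h x).
Proof. by move=> hh; rewrite /= val2_top. Qed.

Lemma iota_imp : {morph @iota I : x y / x ~> y >-> x ~> y}.
Proof.
move=> x y; rewrite /iota /= eta_imp; congr cubic_eta.
apply: interval_eq => h hh; rewrite !(val2_interval_cimp _ _ hh).
rewrite !(val2_interval_Delta (leUl _ _) hh) !(val2_joinE _ _ hh).
rewrite !(val2_interval_embed _ hh) hh.
by case: (h x); case: (h y).
Qed.

(** Similarity says that reflecting [<1, x>] in [<1, x \/ y>] gives [<1, y>]: the first components
    yield y <= x, the second ones x <= y. *)
Lemma iota_inj : injective (@iota I).
Proof.
move=> x y /eta_eq xy; apply: val2_eq => h hh.
have := val2_interval_Delta (leUl (interval_embed x) (interval_embed y)) hh.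
rewrite xy !(val2_joinE _ _ hh) !(val2_interval_embed _ hh).
by case: (h x); case: (h y) => -[].
Qed.

Lemma iota_imeet p : iota (imeet p.1 p.2) = cubic_eta p.
Proof.
(* The common lower bound [m] makes [imeet] the true meet rather than its default value. *)
have [m mp1 mp2] := interval_lb p.
apply/eta_eq/interval_eq => h hh.
rewrite !(val2_interval_Delta (leUl _ _) hh) !(val2_joinE _ _ hh).
rewrite !(val2_interval_embed _ hh) (val2_imeet hh mp1 mp2).
by move: (interval_or p hh); case: (h p.1); case: (h p.2).
Qed.

End Embedding.

Theorem theorem4p2 (I : implicationAlgType) : imp_iso (@iota I).
Proof.
split; first exact: iota_imp.
pose meet_repr (u : cubic_quot (interval_alg I)) :=
  imeet (repr u).1 (repr u).2.
have meet_reprK : cancel meet_repr (@iota I).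
  by move=> u; rewrite iota_imeet /cubic_eta reprK.
(* A right inverse of an injective map is two-sided, whichever representatives [repr] picks. *)
by exists meet_repr => // x; apply: iota_inj; rewrite meet_reprK.
Qed.
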